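(* Let $\mathcal{F}_e=\{e_j\}_{j\in\mathbb{J}}$ be a Parseval frame of nonzero vectors in $\mathcal{H}$, let $\mathsf{E}=\{E_j\}_{j\in\mathbb{J}}$ be a set of distinct real numbers (i.e. $E_i\neq E_j$ whenever $i\neq j$), and let $F_{\mathsf{E},e}$ be the POVM $$F_{\mathsf{E},e}(\Delta)=\sum_{j\in\mathbb{J}:\,E_j\in\Delta}\langle\cdot,e_j\rangle e_j,\qquad \Delta\in\mathcal{B}(\mathbb{R}).$$ The following are equivalent: (i) $F_{\mathsf{E},e}$ is a commutative POVM; (ii) there exists an orthonormal basis $\{\gamma_i\}_{i=1}^{\dim\mathcal{H}}$ of $\mathcal{H}$ such that $$\mathcal{F}_e=\{c_1^k\gamma_1\}_{k=1}^{r_1}\cup\{c_2^k\gamma_2\}_{k=1}^{r_2}\cup\{c_3^k\gamma_3\}_{k=1}^{r_3}\cup\cdots,$$ where $$\sum_{k=1}^{r_i}|c_i^k|^2=1,\qquad c_i^k\neq 0,\qquad 1\leq i\leq\dim\mathcal{H},\qquad r_i\in\mathbb{N}\cup\{\infty\}.$$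
   Context: $\mathcal{H}$ is a separable Hilbert space with inner product $\langle\cdot,\cdot\rangle$ linear in the first argument, and $\mathbb{J}$ is a finite or countable subset of the integers. A Parseval frame in $\mathcal{H}$ is a family $\{e_j\}_{j\in\mathbb{J}}\subset\mathcal{H}$ with $\sum_{j\in\mathbb{J}}|\langle f,e_j\rangle|^2=\|f\|^2$ for all $f\in\mathcal{H}$. Throughout, Parseval frames contain no zero vectors. $\mathcal{B}(\mathbb{R})$ is the Borel $\sigma$-algebra of $\mathbb{R}$. A (normalized) positive operator-valued measure (POVM) is a map $F$ from $\mathcal{B}(\mathbb{R})$ to the positive bounded operators on $\mathcal{H}$ (positive meaning $\langle Lf,f\rangle\ge 0$) that is countably additive on disjoint Borel sets (series converging strongly) with $F(\mathbb{R})=I$. It is commutative if $F(\Delta_1)F(\Delta_2)=F(\Delta_2)F(\Delta_1)$ for all $\Delta_1,\Delta_2\in\mathcal{B}(\mathbb{R})$. The equality of $\mathcal{F}_e$ with the union in (ii) is understood as equality of families of vectors up to re-indexing (repetitions are allowed). *)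

(* Defs.v *)
From HB Require Import structures.
From mathcomp Require Import all_boot all_order all_algebra finmap.
From mathcomp Require Import sesquilinear complex.
From mathcomp Require Import all_classical all_reals all_analysis.
From mathcomp Require summability.

Set Implicit Arguments.
Unset Strict Implicit.
Unset Printing Implicit Defensive.

Import Order.TTheory GRing.Theory Num.Theory.
Import numFieldNormedType.Exports.

Local Open Scope classical_set_scope.
Local Open Scope ring_scope.

(* Complex Hilbert spaces. A form [{dot V for conj}] is linear in its first
   argument and conjugate-linear in the second. The norm, and hence the
   topology and the completeness, are those of the inner product. *)
HB.mixin Record CompleteNormedModule_isHilbert (R : realType) V
    & CompleteNormedModule R[i] V := {
  inner : {dot V for (@Num.conj R[i])};
  sqr_norm_inner : forall f : V, `|f| ^+ 2 = inner f f
}.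

#[short(type="hilbertType")]
HB.structure Definition Hilbert (R : realType) :=
  { V of CompleteNormedModule R[i] V & CompleteNormedModule_isHilbert R V }.

Definition separable (T : topologicalType) : Prop :=
  exists2 S : set T, countable S & dense S.

(* [complex.Re] only casts the real number |z|^2 from R[i] down to R, which the
   nonnegative sums [\esum] require. *)
Definition parseval_frame (R : realType) (H : hilbertType R)
    (J : set int) (e : int -> H) : Prop :=
  forall f : H,
    (\esum_(j in J) (complex.Re (`|inner f (e j)| ^+ 2))%:E = (complex.Re (`|f| ^+ 2))%:E)%E.

(* Unconditional sum: the norm limit of the partial sums along the net of
   finite subsets of D, ordered by inclusion. *)
Definition usum (R : realType) (H : hilbertType R) (D : set int)
    (x : int -> H) : H :=
  lim ((fun A : {fset int} => \sum_(j <- A | j \in D) x j)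
         @ summability.totally).

(* The values of e and E outside J are irrelevant. *)
Definition frame_povm (R : realType) (H : hilbertType R)
    (J : set int) (E : int -> R) (e : int -> H) (D : set R) : H -> H :=
  fun f => usum [set j | J j /\ D (E j)] (fun j => inner f (e j) *: e j).

Definition bounded_operator (R : realType) (H : hilbertType R)
    (L : H -> H) : Prop :=
  linear L /\ exists M : R, forall f : H, `|L f| <= M%:C%C * `|f|.

(* On R[i], [0 <= z] means that z is real and nonnegative. *)
Definition positive_operator (R : realType) (H : hilbertType R)
    (L : H -> H) : Prop :=
  forall f : H, 0 <= inner (L f) f.

(* [measurable] on R is the Borel sigma-algebra; values of F on sets that are
   not measurable are irrelevant. *)
Definition is_povm (R : realType) (H : hilbertType R)
    (F : set R -> H -> H) : Prop :=
  [/\ forall D : set R, measurable D ->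
        bounded_operator (F D) /\ positive_operator (F D),
      forall A : nat -> set R, (forall n, measurable (A n)) ->
        trivIset [set: nat] A ->
        forall f : H,
          series (fun n => F (A n) f) @ \oo --> F (\bigcup_n A n) f
    & forall f : H, F [set: R] f = f].

Definition commutative_povm (R : realType) (H : hilbertType R)
    (F : set R -> H -> H) : Prop :=
  is_povm F /\
  forall D1 D2 : set R, measurable D1 -> measurable D2 ->
    F D1 \o F D2 = F D2 \o F D1.

(* Index ranges with N \cup {oo} many elements, counted from 0:
   [Some n] stands for {0, ..., n-1} and [None] (infinity) for all of nat. *)
Definition index_range (d : option nat) : set nat :=
  if d is Some n then `I_n else [set: nat].

(* An orthonormal family with dense linear span; its number of elements d is
   then the Hilbert dimension of H. *)
Definition orthonormal_basis (R : realType) (H : hilbertType R)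
    (d : option nat) (gamma : nat -> H) : Prop :=
  (forall i j : nat, index_range d i -> index_range d j ->
     inner (gamma i) (gamma j) = (i == j)%:R) /\
  dense [set v : H | exists (A : {fset nat}) (a : nat -> R[i]),
           (forall i, i \in A -> index_range d i) /\
           v = \sum_(i <- A) a i *: gamma i].

(* Main.v *)
(* The singletons give F({E_j}) = <., e_j> e_j, so commutativity of F makes the
   rank-one operators of the frame commute, and two of these commute exactly
   when the vectors are orthogonal or parallel. Parallelism is then an
   equivalence relation on J; one unit vector per class gives an orthonormal
   family, which is total because f is the sum of the <f, e_j> e_j, and the
   Parseval identity at a basis vector is the normalization of its coefficients.
   Conversely, the rank-one operators attached to multiples of orthonormal
   vectors commute, and this passes to the unconditional sums F(D). That F is a
   POVM holds for every Parseval frame. *)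
Require Import Defs.
From HB Require Import structures.
From mathcomp Require Import all_boot all_order all_algebra finmap.
From mathcomp Require Import sesquilinear complex.
From mathcomp Require Import all_classical all_reals all_analysis.
From mathcomp Require summability.
From mathcomp Require Import ring.

Set Implicit Arguments.
Unset Strict Implicit.
Unset Printing Implicit Defensive.

Import Order.TTheory GRing.Theory Num.Theory.
Import numFieldNormedType.Exports.

Local Open Scope classical_set_scope.
Local Open Scope ring_scope.

(** * Algebra of the inner product *)

Section InnerProduct.
Context (R : realType) (H : hilbertType R).
Implicit Types (f g h : H) (a : R[i]).

Lemma innerDl f g h : inner (f + g) h = inner f h + inner g h.
Proof. by rewrite linearDl. Qed.

Lemma innerDr f g h : inner f (g + h) = inner f g + inner f h.
Proof. by rewrite linearDr. Qed.

Lemma innerZl a f g : inner (a *: f) g = a * inner f g.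
Proof. by rewrite linearZl_LR. Qed.

Lemma innerZr a f g : inner f (a *: g) = a^* * inner f g.
Proof. by rewrite linearZr_LR. Qed.

Lemma inner0l f : inner 0 f = 0.
Proof. by rewrite linear0l. Qed.

Lemma inner0r f : inner f 0 = 0.
Proof. by rewrite linear0r. Qed.

Lemma innerBl f g h : inner (f - g) h = inner f h - inner g h.
Proof. by rewrite linearBl. Qed.

Lemma innerBr f g h : inner f (g - h) = inner f g - inner f h.
Proof. by rewrite linearBr. Qed.

Lemma inner_suml I (r : seq I) (P : pred I) (x : I -> H) f :
  inner (\sum_(i <- r | P i) x i) f = \sum_(i <- r | P i) inner (x i) f.
Proof.
by elim/big_rec2: _ => [|i y z _ <-]; rewrite ?inner0l// innerDl.
Qed.

Lemma inner_sumr I (r : seq I) (P : pred I) (x : I -> H) f :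
  inner f (\sum_(i <- r | P i) x i) = \sum_(i <- r | P i) inner f (x i).
Proof.
by elim/big_rec2: _ => [|i y z _ <-]; rewrite ?inner0r// innerDr.
Qed.

Lemma inner_conj f g : (inner f g)^* = inner g f.
Proof.
by rewrite (hermC (eps := false) (theta := Num.conj) (inner (s := H)) g f) mul1r.
Qed.

Lemma norm_innerC f g : `|inner f g| = `|inner g f|.
Proof. by rewrite -inner_conj norm_conjC. Qed.

Lemma sqr_normB f g :
  `|f - g| ^+ 2 = `|f| ^+ 2 + `|g| ^+ 2 - (inner f g + (inner f g)^*).
Proof.
rewrite !sqr_norm_inner innerBl !innerBr -(inner_conj g f) conjCK.
by rewrite inner_conj opprB opprD addrACA -!addrA; congr (_ + _); rewrite addrCA.
Qed.

End InnerProduct.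

(** * The Cauchy-Schwarz inequality and continuity of the inner product *)

Section CauchySchwarz.
Context (R : realType) (H : hilbertType R).

Lemma inner_le (f g : H) : `|inner f g| <= `|f| * `|g|.
Proof.
have [->|g0] := eqVneq g 0; first by rewrite inner0r !normr0 mulr0.
have ng0 : 0 < `|g| by rewrite normr_gt0.
have gg0 : 0 < `|g| ^+ 2 by rewrite exprn_gt0.
rewrite -(@ler_pXn2r _ 2)// ?nnegrE ?mulr_ge0// exprMn -ler_pdivrMr//.
rewrite -subr_ge0.
(* The difference is the squared norm of the component of [f] orthogonal to [g]. *)
suff -> : `|f| ^+ 2 - `|inner f g| ^+ 2 / `|g| ^+ 2 =
    `|f - (inner f g / `|g| ^+ 2) *: g| ^+ 2 by rewrite exprn_ge0.
have conjg : (`|g| ^+ 2)^* = `|g| ^+ 2 by rewrite geC0_conj// ltW.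
have dotE : (inner f g / `|g| ^+ 2)^* * inner f g = `|inner f g| ^+ 2 / `|g| ^+ 2.
  by rewrite rmorphM fmorphV /= conjg normCKC mulrAC.
rewrite sqr_normB normrZ innerZr dotE normf_div (ger0_norm (ltW gg0)).
rewrite geC0_conj ?divr_ge0 ?exprn_ge0//.
by field; rewrite gt_eqF.
Qed.

Lemma continuous_innerl (g : H) : continuous (fun f => inner f g).
Proof.
move=> f; apply/cvgrPdist_le => eps eps0.
(* Adding [1] keeps the denominator positive when [g] is zero. *)
have d0 : 0 < eps / (`|g| + 1) by rewrite divr_gt0// ltr_wpDl.
near=> h; rewrite -innerBl (le_trans (inner_le _ _))//.
have : `|f - h| <= eps / (`|g| + 1).
  by near: h; apply: cvgr_dist_le d0; exact: cvg_id.
rewrite ler_pdivlMr ?ltr_wpDl// => /(le_trans _); apply.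
by rewrite ler_wpM2l// lerDl.
Unshelve. all: by end_near. Qed.

End CauchySchwarz.

(** * Unconditional sums along the net of finite sets *)

Lemma big_fset_setD (V : nmodType) (A B : {fset int}) (P : pred int)
    (x : int -> V) : (A `<=` B)%fset ->
  \sum_(j <- B | P j) x j =
  \sum_(j <- A | P j) x j + \sum_(j <- (B `\` A)%fset | P j) x j.
Proof.
move=> AB; rewrite -big_cat /= -[LHS]big_filter -[RHS]big_filter.
apply: perm_big; apply: uniq_perm; rewrite ?filter_uniq ?cat_uniq ?fset_uniq//=.
  by rewrite andbT; apply/hasPn => j; rewrite in_fsetD => /andP[].
move=> j; rewrite !mem_filter mem_cat in_fsetD.
by case: (boolP (j \in A)) => [/(fsubsetP AB) ->|].
Qed.

Section UnconditionalSums.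
Context (R : realType) (H : hilbertType R).
Implicit Types (J D : set int) (x y : int -> H).
Local Notation totally := (@summability.totally int).

#[local] Existing Instance summability.totally_filter.

(** The Cauchy criterion for unconditional summability. Completeness turns it into convergence of
    the net, and it passes to subsets of [J], so a single estimate on the whole frame serves every
    Borel set. *)
Definition uniform_tails J x : Prop :=
  forall eps : R[i], 0 < eps -> exists A : {fset int}, forall B : {fset int},
    {in B, forall j, j \notin A} ->
    `|\sum_(j <- B | j \in J) x j| <= eps.

Lemma near_totally (P : {fset int} -> Prop) (A : {fset int}) :
  (forall B, (A `<=` B)%fset -> P B) -> \forall B \near totally, P B.
Proof. by move=> AP; exists A. Qed.

Lemma big_fset_filter (A : {fset int}) (P Q : pred int) x :
  \sum_(j <- [fset j in A | Q j]%fset | P j) x j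
  = \sum_(j <- A | Q j && P j) x j.
Proof.
rewrite -[RHS]big_filter_cond; apply: perm_big; apply: uniq_perm => //.
  by rewrite filter_uniq.
by move=> j; rewrite !inE mem_filter andbC.
Qed.

(** The part of [B] lying in [D] is again a finite set avoiding [A], and the criterion on [J]
    applies to it. *)
Lemma uniform_tailsS J D x : D `<=` J -> uniform_tails J x -> uniform_tails D x.
Proof.
move=> DJ Jx eps /Jx[A AP]; exists A => B BA.
rewrite (eq_bigl (fun j => (j \in D) && (j \in J))); last first.
  by move=> j; case: (boolP (j \in D)) => // /set_mem /DJ /mem_set ->.
rewrite -(big_fset_filter B (mem J) (fun j => j \in D)); apply: AP => j.
by rewrite !inE => /andP[/BA].
Qed.

Lemma usum_cvg D x : uniform_tails D x ->
  (fun A : {fset int} => \sum_(j <- A | j \in D) x j) @ totally --> usum D x.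
Proof.
move=> Dx; apply: cauchy_cvg; apply: cauchy_exP => eps eps0.
(* Half of [eps], because the criterion gives a large inequality and the ball asks for a strict
   one. *)
have [A AP] := Dx _ (divr_gt0 eps0 (ltr0Sn _ 1)).
exists (\sum_(j <- A | j \in D) x j).
apply: (@near_totally _ A) => B AB.
rewrite /= -ball_normE /ball_ /= distrC.
rewrite (big_fset_setD _ _ AB) addrAC subrr add0r.
apply: (le_lt_trans (AP _ _)); first by move=> j; rewrite inE => /andP[].
by rewrite ltr_pdivrMr// ltr_pMr// ltr1n.
Qed.

Lemma usum_unique D x (l : H) :
  (fun A : {fset int} => \sum_(j <- A | j \in D) x j) @ totally --> l ->
  usum D x = l.
Proof. by move=> h; apply: cvg_lim => //; exact: norm_hausdorff. Qed.

Lemma eq_usum D x y : (forall j, D j -> x j = y j) -> usum D x = usum D y.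
Proof.
move=> xy; rewrite /usum.
suff -> : (fun A : {fset int} => \sum_(j <- A | j \in D) x j) =
  (fun A : {fset int} => \sum_(j <- A | j \in D) y j) by [].
by apply/funext => A; apply: eq_bigr => j /set_mem /xy.
Qed.

Lemma usum_set0 x : usum set0 x = 0.
Proof.
apply: usum_unique; apply: cvg_near_cst; apply: nearW => A.
by rewrite big_pred0// => j; rewrite in_set0.
Qed.

Lemma usum_set1 j x : usum [set j] x = x j.
Proof.
apply: usum_unique; apply: cvg_near_cst; apply: (@near_totally _ [fset j]%fset).
move=> A /fsubsetP/(_ j); rewrite in_fset1 eqxx => /(_ isT) jA.
rewrite (eq_bigl (pred1 j)); last by move=> i; rewrite in_set1.
by rewrite -big_filter filter_pred1_uniq ?fset_uniq// big_seq1.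
Qed.

Lemma usum_lim_le D x (M : R[i]) : uniform_tails D x ->
  (forall A : {fset int}, `|\sum_(j <- A | j \in D) x j| <= M) ->
  `|usum D x| <= M.
Proof.
move=> /usum_cvg Dx DM; apply/ler_addgt0Pr => eps eps0.
have /cvgrPdist_le/(_ _ eps0)/filter_ex[A] := Dx.
move=> /(le_trans (lerB_dist _ _)); rewrite lerBlDr => /le_trans; apply.
by rewrite addrC lerD2r.
Qed.

Lemma usum_linear D x y (a : R[i]) : uniform_tails D x -> uniform_tails D y ->
  usum D (fun j => a *: x j + y j) = a *: usum D x + usum D y.
Proof.
move=> /usum_cvg Dx /usum_cvg Dy; apply: usum_unique.
under eq_fun do rewrite big_split -scaler_sumr.
by apply: cvgD => //; apply: cvgZr.
Qed.

Lemma usumU D D' x : [disjoint D & D'] -> uniform_tails (D `|` D') x ->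
  usum (D `|` D') x = usum D x + usum D' x.
Proof.
move=> DD' xt; apply: usum_unique.
have /usum_cvg Dx := uniform_tailsS (@subsetUl _ D D') xt.
have /usum_cvg D'x := uniform_tailsS (@subsetUr _ D D') xt.
suff -> : (fun A : {fset int} => \sum_(j <- A | j \in D `|` D') x j) =
  (fun A : {fset int} => \sum_(j <- A | j \in D) x j + \sum_(j <- A | j \in D') x j).
  exact: cvgD.
apply/funext => A; rewrite (bigID (mem D)) /=; congr (_ + _); apply: eq_bigl => j.
  by rewrite in_setU; case: (j \in D); rewrite ?andbF.
rewrite in_setU; case: (boolP (j \in D)); rewrite ?andbF ?andbT// => /set_mem Dj.
apply/esym/negbTE/negP => /set_mem D'j.
by move/disj_setPS: DD' => /(_ j (conj Dj D'j)).
Qed.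

(** Serves twice in the commutation argument: with [L] a rank-one frame term, and with [L] a whole
    operator [frame_povm J E e D]. *)
Lemma raddf_usum (L : H -> H) D x : L 0 = 0 -> {morph L : f g / f + g} ->
  continuous L -> uniform_tails D x -> L (usum D x) = usum D (L \o x).
Proof.
move=> L0 LD Lc /usum_cvg Dx; apply/esym/usum_unique.
suff -> : (fun A : {fset int} => \sum_(j <- A | j \in D) (L \o x) j) =
  L \o (fun A : {fset int} => \sum_(j <- A | j \in D) x j).
  apply: continuous_cvg Dx; exact: Lc.
by apply/funext => A; rewrite /= (big_morph L LD L0).
Qed.

(** The [n]-th partial sum of the series is the sum over [U n], so the error is the sum over the
    rest of the union. Once [U n] has absorbed every index of the union lying in the finite set [A]
    of the Cauchy criterion, that rest avoids [A] and its sum is small. *)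
Lemma usum_bigcup J (D : nat -> set int) x : uniform_tails J x ->
  (forall n, D n `<=` J) -> trivIset setT D ->
  series (fun n => usum (D n) x) @ \oo --> usum (\bigcup_n D n) x.
Proof.
move=> Jx DJ Dtriv; pose U n := \bigcup_(k < n) D k.
have UJ n : U n `<=` J by move=> j [k _ /DJ].
have DU : \bigcup_n D n `<=` J by move=> j [k _ /DJ].
have seriesE n : series (fun n => usum (D n) x) n = usum (U n) x.
  elim: n => [|n IHn]; first by rewrite seriesEnat /= big_geq// /U bigcup0 ?usum_set0.
  rewrite seriesSr IHn -usumU.
  - congr usum; rewrite /U; apply/seteqP; split => j.
      by case=> [[k /= kn Dj]|Dj]; [exists k => //=; exact: ltnW|exists n => /=].
    case=> k /=; rewrite ltnS leq_eqVlt => /predU1P[->|kn] Dj; first by right.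
    by left; exists k.
  - apply/disj_setPS => j [[k /= kn Dkj] Dnj].
    have : D k `&` D n !=set0 by exists j.
    by move=> /(Dtriv k n I I) kE; rewrite kE ltnn in kn.
  - by apply: uniform_tailsS Jx => j [/UJ//|/DJ].
apply/cvgrPdist_le => eps eps0.
have [A AP] := Jx _ eps0.
(* [f j] is a piece containing [j], with default [0] outside the union; the maximum of [f] over [A]
   then tells how many pieces cover the relevant part of [A]. *)
have /choice[f fP] : forall j, exists n, (\bigcup_n D n) j -> D n j.
  move=> j; have [[n _ Dj]|?] := pselect ((\bigcup_n D n) j); first by exists n.
  by exists 0%N.
pose N := (\max_(j <- A) f j)%N.
near=> n; rewrite seriesE.
have Nn : (N < n)%N by near: n; exact: nbhs_infty_gt.
have -> : \bigcup_n D n = U n `|` (\bigcup_n D n `\` U n).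
  by rewrite setDUK// => j [k _ Dj]; exists k.
rewrite usumU; first last.
- by apply: uniform_tailsS Jx => j [/UJ//|[/DU]].
- by apply/disj_setPS => j [Uj []].
rewrite addrAC subrr add0r; apply: usum_lim_le.
  by apply: uniform_tailsS Jx => j [/DU].
move=> B.
rewrite (eq_bigl (fun j => (j \in \bigcup_n D n `\` U n) && (j \in J))); last first.
  move=> j; case: (boolP (j \in _ `\` _)) => // /set_mem [/DU Jj _].
  by rewrite mem_set.
rewrite -(big_fset_filter B (mem J) (fun j => j \in \bigcup_n D n `\` U n)).
apply: AP => j; rewrite in_fset /= inE => /andP[_] /set_mem[Dj nUj]; apply/negP => jA.
apply: nUj; exists (f j); last exact: fP.
by rewrite /= (leq_trans _ Nn)// ltnS /N; apply: leq_bigmax_seq.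
Unshelve. all: by end_near. Qed.

End UnconditionalSums.

(** * Sums and limits of nonnegative complex numbers *)

Section RealSums.
Context (R : realType).
Implicit Types (J : set int) (a : int -> R[i]) (s : R[i]).

Lemma ge0_RRe (z : R[i]) : 0 <= z -> z = (complex.Re z)%:C%C.
Proof. by move=> z0; rewrite RRe_real// ger0_real. Qed.

Lemma sum_RRe a (A : {fset int}) (P : pred int) : (forall j, 0 <= a j) ->
  \sum_(j <- A | P j) a j = (\sum_(j <- A | P j) complex.Re (a j))%:C%C.
Proof.
by move=> a0; rewrite rmorph_sum; apply: eq_bigr => j _; exact: ge0_RRe.
Qed.

(** Together with [esum_RRe_approx], translates the extended-real Parseval identity into bounds on
    finite sums in [R[i]], where the norms of [H] live. *)
Lemma esum_RRe_le J a s (A : {fset int}) : (forall j, 0 <= a j) -> 0 <= s ->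
  (\esum_(j in J) (complex.Re (a j))%:E = (complex.Re s)%:E)%E ->
  \sum_(j <- A | j \in J) a j <= s.
Proof.
move=> a0 s0 sE; rewrite sum_RRe// (ge0_RRe s0) lecR -lee_fin -sE -sumEFin.
apply: esum_ge; exists [set` [fset j in A | j \in J]%fset].
  by split=> // j /=; rewrite !inE /= => /andP[_ /set_mem].
rewrite fsbig_finite//= set_fsetK.
rewrite le_eqVlt; apply/orP; left; apply/eqP.
rewrite -big_filter; apply: perm_big; apply: uniq_perm; rewrite ?filter_uniq ?fset_uniq//.
by move=> j; rewrite !inE mem_filter andbC.
Qed.

Lemma esum_RRe_approx J a s (eps : R[i]) : (forall j, 0 <= a j) -> 0 <= s ->
  (\esum_(j in J) (complex.Re (a j))%:E = (complex.Re s)%:E)%E ->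
  0 < eps -> exists A : {fset int}, s <= \sum_(j <- A | j \in J) a j + eps.
Proof.
move=> a0 s0 sE eps0.
have Reps0 : (0 < complex.Re eps)%R by move: eps0; rewrite ltcE => /andP[].
have sfin : (\esum_(j in J) (complex.Re (a j))%:E)%E \is a fin_num by rewrite sE.
(* [\esum] is a supremum over finite subsets and is finite here, so some [X] comes within [eps] of
   it. *)
have [_ [X [finX XJ] <-]] := ub_ereal_sup_adherent Reps0 sfin.
rewrite -/(esum _ _) sE fsbig_finite// sumEFin -EFinB lte_fin ltrBlDr => /ltW sX.
exists (fset_set X).
have <- : \sum_(j <- fset_set X) a j = \sum_(j <- fset_set X | j \in J) a j.
  rewrite [RHS]big_mkcond; apply: eq_big_seq => j.
  by rewrite in_fset_set// => /set_mem/XJ/mem_set ->.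
rewrite sum_RRe// (ge0_RRe s0) [leRHS](_ : _ =
  (\sum_(j <- fset_set X) complex.Re (a j) + complex.Re eps)%:C%C) ?lecR//.
by rewrite rmorphD /= -(ge0_RRe (ltW eps0)).
Qed.

End RealSums.

(** The order of [K] may be partial, as on [R[i]], so [l] is instead shown equal to its own norm:
    [u] coincides with its pointwise norm, which converges to the norm of [l], and limits are
    unique. *)
Lemma cvg_ge0_numField (K : numFieldType) T (F : set_system T) (u : T -> K) (l : K)
  {FF : ProperFilter F} : u @ F --> l -> (forall t, 0 <= u t) -> 0 <= l.
Proof.
move=> ul u0; suff -> : l = `|l| by [].
have hR : hausdorff_space K by exact: norm_hausdorff.
apply: (cvg_unique hR ul); have -> : u = (fun t => `|u t|).
  by apply/funext => t; rewrite ger0_norm.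
exact: cvg_norm.
Qed.

(** * The POVM of a Parseval frame *)

Section ParsevalFrames.
Context (R : realType) (H : hilbertType R) (J : set int) (E : int -> R)
  (e : int -> H).
Hypothesis frame : parseval_frame J e.
Implicit Types (f g : H) (D : set R).
#[local] Existing Instance summability.totally_filter.

Definition frame_term f (j : int) : H := inner f (e j) *: e j.

Lemma bessel f (A : {fset int}) :
  \sum_(j <- A | j \in J) `|inner f (e j)| ^+ 2 <= `|f| ^+ 2.
Proof.
apply: (@esum_RRe_le _ _ (fun j => `|inner f (e j)| ^+ 2)); last exact: frame.
  by move=> j; rewrite exprn_ge0.
by rewrite exprn_ge0.
Qed.

Lemma parseval_approx f (eps : R[i]) : 0 < eps -> exists A : {fset int},
  `|f| ^+ 2 <= \sum_(j <- A | j \in J) `|inner f (e j)| ^+ 2 + eps.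
Proof.
apply: (@esum_RRe_approx _ _ (fun j => `|inner f (e j)| ^+ 2)); last exact: frame.
  by move=> j; rewrite exprn_ge0.
by rewrite exprn_ge0.
Qed.

(* With S the partial sum, AM-GM gives
   2 |S|^2 = sum of 2 Re (<f, e_j> <e_j, S>) <= sum of |<f, e_j>|^2 + |<S, e_j>|^2,
   and the last term is at most |S|^2 by Bessel. *)
Lemma sqr_norm_frame_sum f (A : {fset int}) :
  `|\sum_(j <- A | j \in J) frame_term f j| ^+ 2
  <= \sum_(j <- A | j \in J) `|inner f (e j)| ^+ 2.
Proof.
set S := \sum_(j <- A | _) _.
have SE : `|S| ^+ 2 = \sum_(j <- A | j \in J) inner f (e j) * (inner S (e j))^*.
  rewrite sqr_norm_inner {1}/S inner_suml; apply: eq_bigr => j _.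
  by rewrite innerZl inner_conj.
have S2 : `|S| ^+ 2 + `|S| ^+ 2 <=
    \sum_(j <- A | j \in J) `|inner f (e j)| ^+ 2 + `|S| ^+ 2.
  rewrite (le_trans _ (lerD (lexx _) (bessel S A)))//.
  have SR : `|S| ^+ 2 = (`|S| ^+ 2)^* by rewrite geC0_conj// exprn_ge0.
  rewrite {2}SR SE rmorph_sum -!big_split /=; apply: ler_sum => j _.
  rewrite rmorphM /= conjCK -subr_ge0.
  suff -> : `|inner f (e j)| ^+ 2 + `|inner S (e j)| ^+ 2 -
     (inner f (e j) * (inner S (e j))^* + (inner f (e j))^* * inner S (e j)) =
     `|inner f (e j) - inner S (e j)| ^+ 2 by rewrite exprn_ge0.
  by rewrite !normCK rmorphB /=; ring.
by move: S2; rewrite lerD2r.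
Qed.

Lemma sqr_norm_frame_sum_le f (A : {fset int}) :
  `|\sum_(j <- A | j \in J) frame_term f j| ^+ 2 <= `|f| ^+ 2.
Proof. exact: le_trans (sqr_norm_frame_sum _ _) (bessel _ _). Qed.

(** Choose [A] carrying all but [eps ^+ 2] of the squared norm of [f]. By Bessel on the union of [A]
    and [B], the coefficients on a [B] disjoint from [A] have square sum at most [eps ^+ 2], which
    dominates the squared norm of the sum over [B]. *)
Lemma frame_tails f : uniform_tails J (frame_term f).
Proof.
move=> eps eps0; have [A AP] := parseval_approx f (exprn_gt0 2 eps0).
exists A => B BA; rewrite -(@ler_pXn2r _ 2)// ?nnegrE ?(ltW eps0)//.
apply: le_trans (sqr_norm_frame_sum _ _) _.
have := le_trans (bessel f (A `|` B)%fset) AP.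
rewrite (big_fset_setD _ _ (fsubsetUl A B)) lerD2l fsetDUl fsetDv fset0U.
suff -> : (B `\` A)%fset = B by [].
by apply/fsetP => j; rewrite in_fsetD; case: (boolP (j \in B)) => [/BA ->|_];
  rewrite ?andbF.
Qed.

Lemma sub_frame_tails D f :
  uniform_tails [set j | J j /\ D (E j)] (frame_term f).
Proof. by apply: uniform_tailsS (frame_tails f) => j []. Qed.

Lemma frame_povm_linear D : linear (frame_povm J E e D).
Proof.
move=> a f g; rewrite /frame_povm -usum_linear; try exact: sub_frame_tails.
by apply: eq_usum => j _; rewrite innerDl innerZl scalerDl scalerA.
Qed.

Lemma frame_povm_le D f : `|frame_povm J E e D f| <= `|f|.
Proof.
apply: usum_lim_le; first exact: sub_frame_tails.
move=> A; rewrite -(@ler_pXn2r _ 2)// ?nnegrE//.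
rewrite (eq_bigl (fun j => (j \in [set j | J j /\ D (E j)]) && (j \in J))).
  by rewrite -big_fset_filter; exact: sqr_norm_frame_sum_le.
move=> j; case: (boolP (j \in _)) => // /set_mem[Jj _].
by rewrite mem_set.
Qed.

(** A linear contraction is 1-Lipschitz. *)
Lemma frame_povm_continuous D : continuous (frame_povm J E e D).
Proof.
move=> f; apply/cvgrPdist_le => eps eps0; near=> g.
rewrite -[X in `|_ - X|]scale1r -scaleN1r scalerA addrC mulr1.
rewrite -frame_povm_linear (le_trans (frame_povm_le _ _))// scaleN1r addrC.
by near: g; apply: cvgr_dist_le eps0; exact: cvg_id.
Unshelve. all: by end_near. Qed.

(** Pairing a partial sum with [f] gives a finite sum of squared moduli, and nonnegativity survives
    the limit. *)
Lemma frame_povm_positive D : positive_operator (frame_povm J E e D).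
Proof.
move=> f; have cvgF := cvg_comp _ _ (usum_cvg (sub_frame_tails D f))
  (@continuous_innerl _ _ f _).
have SE (A : {fset int}) :
    inner (\sum_(j <- A | j \in [set j | J j /\ D (E j)]) frame_term f j) f =
    \sum_(j <- A | j \in [set j | J j /\ D (E j)]) `|inner f (e j)| ^+ 2.
  rewrite inner_suml; apply: eq_bigr => j _.
  by rewrite innerZl -(inner_conj f) normCK.
apply: (cvg_ge0_numField cvgF) => A /=.
by rewrite SE sumr_ge0// => j _; rewrite exprn_ge0.
Qed.

(** Let [S] be a partial sum and [T] its square sum of coefficients. Then [inner f S = T] and the
    squared norm of [S] is at most [T], so the squared norm of [f - S] is at most that of [f] minus
    [T], which Parseval makes small. *)
Lemma frame_povmT f : frame_povm J E e setT f = f.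
Proof.
apply: usum_unique; rewrite (_ : [set j | J j /\ _] = J); last first.
  by apply/seteqP; split => j // [].
apply/cvgrPdist_le => eps eps0.
have [A AP] := parseval_approx f (exprn_gt0 2 eps0).
exists A => // B /= AB; rewrite -(@ler_pXn2r _ 2)// ?nnegrE ?(ltW eps0)//.
pose T := \sum_(j <- B | j \in J) `|inner f (e j)| ^+ 2.
have T0 : 0 <= T by rewrite sumr_ge0// => j _; rewrite exprn_ge0.
have TE : inner f (\sum_(j <- B | j \in J) frame_term f j) = T.
  rewrite inner_sumr; apply: eq_bigr => j _.
  by rewrite innerZr normCKC.
rewrite sqr_normB TE geC0_conj//.
apply: (@le_trans _ _ (`|f| ^+ 2 + T - (T + T))).
  by rewrite lerD2r lerD2l sqr_norm_frame_sum.
rewrite opprD addrA addrK lerBlDr addrC; apply: (le_trans AP).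
rewrite lerD2r /T (big_fset_setD _ _ AB) lerDl; apply: sumr_ge0 => j _.
exact: exprn_ge0.
Qed.

Lemma frame_povm_bigcup (A : nat -> set R) f : trivIset setT A ->
  series (fun n => frame_povm J E e (A n) f) @ \oo
    --> frame_povm J E e (\bigcup_n A n) f.
Proof.
move=> Atriv; rewrite /frame_povm.
rewrite (_ : [set j | J j /\ _] = \bigcup_n [set j | J j /\ A n (E j)]).
  apply: (usum_bigcup (frame_tails f)); first by move=> n j [].
  by move=> m n _ _ [j [[_ Am] [_ An]]]; apply: Atriv => //; exists (E j).
apply/seteqP; split => j; first by case=> Jj [n _ An]; exists n.
by case=> n _ [Jj An]; split => //; exists n.
Qed.

Lemma frame_povm_is_povm : is_povm (frame_povm J E e).
Proof.
split=> [D _|A _ Atriv f|f].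
- split; last exact: frame_povm_positive.
  split; first exact: frame_povm_linear.
  by exists 1 => f; rewrite mul1r frame_povm_le.
- exact: frame_povm_bigcup.
- exact: frame_povmT.
Qed.

End ParsevalFrames.

(** * Commutativity of the POVM and of the rank-one frame terms *)

Section Commutation.
Context (R : realType) (H : hilbertType R) (J : set int) (E : int -> R)
  (e : int -> H).
Hypothesis frame : parseval_frame J e.
Implicit Types (f g : H) (D : set R).

Definition frame_terms_commute : Prop := forall j k, J j -> J k ->
  forall f, frame_term e (frame_term e f k) j = frame_term e (frame_term e f j) k.

Lemma frame_term_continuous k : continuous (fun f => frame_term e f k).
Proof.
move=> f; apply: cvgZl; exact: continuous_innerl.
Qed.

Lemma frame_povm_frame_term D f k : frame_terms_commute -> J k ->
  frame_povm J E e D (frame_term e f k) = frame_term e (frame_povm J E e D f) k.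
Proof.
move=> comm Jk; rewrite [in RHS]/frame_povm.
rewrite (raddf_usum (L := fun f => frame_term e f k)).
- by apply: eq_usum => j [Jj _]; exact: comm.
- by rewrite /frame_term inner0l scale0r.
- by move=> g h; rewrite /frame_term innerDl scalerDl.
- exact: frame_term_continuous.
- exact: sub_frame_tails.
Qed.

(** The operator of [D1] is carried through the sum defining that of [D2] by additivity and
    continuity, then past each rank-one term by [frame_povm_frame_term]. *)
Lemma frame_povm_comm D1 D2 : frame_terms_commute ->
  frame_povm J E e D1 \o frame_povm J E e D2 =
  frame_povm J E e D2 \o frame_povm J E e D1.
Proof.
move=> comm; apply/funext => f /=; have Flin := frame_povm_linear E frame D1.
have FD : {morph frame_povm J E e D1 : g h / g + h}.
  by move=> g h; have := Flin 1 g h; rewrite !scale1r.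
have F0 : frame_povm J E e D1 0 = 0.
  by have := FD 0 0; rewrite addr0 => /(congr1 (fun v => v - frame_povm J E e D1 0));
    rewrite subrr addrK => <-.
rewrite {2}/frame_povm raddf_usum//.
- by apply: eq_usum => j [Jj _] /=; exact: frame_povm_frame_term.
- exact: frame_povm_continuous.
- exact: sub_frame_tails.
Qed.

(** Distinctness of the values leaves [j] as the only index of [J] sent to [E j]. *)
Lemma frame_povm_set1 f j : set_inj J E -> J j ->
  frame_povm J E e [set E j] f = frame_term e f j.
Proof.
move=> Einj Jj; rewrite /frame_povm (_ : [set k | _] = [set j]) ?usum_set1//.
apply/seteqP; split => [k [Jk /= Ejk]|k -> //].
by apply: Einj => //; rewrite inE.
Qed.

Lemma frame_terms_commuteP : set_inj J E ->
  commutative_povm (frame_povm J E e) <-> frame_terms_commute.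
Proof.
move=> Einj; split=> [[_ comm] j k Jj Jk f|comm].
  have /(congr1 (fun F => F f)) /= := comm _ _ (measurable_set1 (E j)) (measurable_set1 (E k)).
  by rewrite !frame_povm_set1.
by split=> [|D1 D2 _ _]; [exact: frame_povm_is_povm|exact: frame_povm_comm].
Qed.

Lemma frame_terms_commute_collinear j k : frame_terms_commute -> J j -> J k ->
  inner (e j) (e k) != 0 -> exists a : R[i], e k = a *: e j.
Proof.
move=> comm Jj Jk jk0.
(* Evaluated at [e j], one order of composition yields a multiple of [e j] and the other a multiple
   [b] of [e k]; as [b] is nonzero, one can solve for [e k]. *)
have := comm j k Jj Jk (e j); rewrite /frame_term !innerZl.
set b := _ * inner (e j) (e k) => kj.
have b0 : b != 0.
  rewrite mulf_neq0// -sqr_norm_inner expf_neq0// normr_eq0.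
  by apply: contraNneq jk0 => ->; rewrite inner0l.
exists (b^-1 * (inner (e j) (e k) * inner (e k) (e j))).
by rewrite -scalerA kj scalerA mulVf// scale1r.
Qed.

End Commutation.

(** * Classes of parallel frame vectors and the basis they produce *)

Lemma index_range_bij (A : set int) :
  exists (d : option nat) (s : int -> nat), set_bij A (index_range d) s.
Proof.
have [/finite_setP[n /card_set_bijP[s sP]]|Ainf] := pselect (finite_set A).
  by exists (Some n), s.
have /card_set_bijP[s sP] := eq_card_nat (countableP A) Ainf.
by exists None, s.
Qed.

Lemma set_bij_section (A : set int) (B : set nat) (s : int -> nat) :
  set_bij A B s -> exists t : nat -> int, forall i, B i -> A (t i) /\ s (t i) = i.
Proof.
move=> [_ _ ssurj].
suff /choice[t tP] : forall i, exists k, B i -> A k /\ s k = i by exists t.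
move=> i; have [Bi|?] := pselect (B i); last by exists 0.
by have [k Ak <-] := ssurj _ Bi; exists k.
Qed.

Section CollinearClasses.
Context (R : realType) (H : hilbertType R) (J : set int) (e : int -> H).
Hypotheses (frame : parseval_frame J e) (e_neq0 : forall j, J j -> e j != 0).
Hypothesis collinear : forall j k, J j -> J k ->
  inner (e j) (e k) != 0 -> exists a : R[i], e k = a *: e j.

(** Under [collinear], non-orthogonality amounts to parallelism of the nonzero frame vectors, so for
    [j] in [J] this is the class of [j]. *)
Let connected (j : int) : set int := [set k | J k /\ inner (e j) (e k) != 0].

(** [xget] depends only on the set it receives, so indices with the same class get equal
    representatives. For [j] in [J] the class contains [j], and [xget] does not fall back on its
    default. *)
Definition class_rep (j : int) : int := xget 0 (connected j).

Lemma inner_ee j : J j -> inner (e j) (e j) != 0.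
Proof. by move=> /e_neq0 ej; rewrite -sqr_norm_inner expf_neq0// normr_eq0. Qed.

Lemma class_repP j : J j -> J (class_rep j) /\ inner (e j) (e (class_rep j)) != 0.
Proof.
move=> Jj; rewrite /class_rep; case: xgetP => [k _ []//|] /(_ j) [].
by split => //; exact: inner_ee.
Qed.

(** Here [e k] is a nonzero multiple of [e j], so both vectors are orthogonal to the same frame
    vectors and their classes are the same set. *)
Lemma eq_class_rep j k : J j -> J k -> inner (e j) (e k) != 0 ->
  class_rep j = class_rep k.
Proof.
move=> Jj Jk jk; have [a ekE] := collinear Jj Jk jk.
have a0 : a != 0.
  by apply: contra_neq (e_neq0 Jk) => a0; rewrite ekE a0 scale0r.
rewrite /class_rep /connected ekE; congr xget; apply/seteqP.
split => l /= [Jl]; rewrite innerZl => jl; split => //.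
  by rewrite mulf_neq0.
by apply: contraNneq jl => ->; rewrite mulr0.
Qed.

Lemma class_rep_id j : J j -> class_rep (class_rep j) = class_rep j.
Proof. by move=> Jj; have [? ?] := class_repP Jj; apply/esym/eq_class_rep. Qed.

Lemma class_rep_ortho j k : J j -> J k -> class_rep j != class_rep k ->
  inner (e j) (e k) = 0.
Proof.
by move=> Jj Jk; apply: contraNeq => jk; apply/eqP; exact: eq_class_rep.
Qed.

Section Basis.
Variables (d : option nat) (s : int -> nat) (t : nat -> int).
Hypothesis sP : set_bij (class_rep @` J) (index_range d) s.
Hypothesis tP :
  forall i, index_range d i -> (class_rep @` J) (t i) /\ s (t i) = i.

Definition class_index (j : int) : nat := s (class_rep j).

Definition class_vector (i : nat) : H := `|e (t i)|^-1 *: e (t i).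

Let repJ j : J j -> (class_rep @` J) (class_rep j).
Proof. by move=> Jj; exists j. Qed.

Lemma class_index_range j : J j -> index_range d (class_index j).
Proof. by move=> Jj; case: sP => sf _ _; exact/sf/repJ. Qed.

Lemma class_repE i : index_range d i ->
  [/\ J (t i), class_rep (t i) = t i & class_index (t i) = i].
Proof.
move=> di; have [[j Jj jt] sti] := tP di; rewrite /class_index -jt class_rep_id//.
by split => //; [exact: (class_repP Jj).1|rewrite jt].
Qed.

Lemma class_rep_index j : J j -> t (class_index j) = class_rep j.
Proof.
move=> Jj; have [tJ st] := tP (class_index_range Jj); case: sP => _ sinj _.
by apply: sinj => //; rewrite inE//; exact: repJ.
Qed.

Lemma class_vector_norm i : index_range d i ->
  inner (class_vector i) (class_vector i) = 1.
Proof.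
move=> /class_repE[Jt _ _]; rewrite -sqr_norm_inner normrZ normfV normr_id.
by rewrite mulVf ?expr1n// normr_eq0 e_neq0.
Qed.

Lemma class_vector_ortho i j : index_range d i -> J j -> class_index j != i ->
  inner (class_vector i) (e j) = 0.
Proof.
move=> di Jj ji; have [Jt tt sti] := class_repE di.
rewrite innerZl class_rep_ortho ?mulr0//; apply: contraNneq ji => tj.
by rewrite /class_index -tj -/(class_index _) sti.
Qed.

Lemma frame_class_vector j : J j ->
  e j = inner (e j) (class_vector (class_index j)) *: class_vector (class_index j).
Proof.
move=> Jj; have [Jr jr] := class_repP Jj.
have rj : inner (e (class_rep j)) (e j) != 0.
  by rewrite -inner_conj conjC_eq0.
have [a ejE] := collinear Jr Jj rj; set g := class_vector _.
have g1 : inner g g = 1 by apply: class_vector_norm; exact: class_index_range.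
have {}ejE : e j = (a * `|e (class_rep j)|) *: g.
  rewrite /g /class_vector class_rep_index// scalerA mulfK//.
  by rewrite normr_eq0 e_neq0.
by rewrite {2}ejE innerZl g1 mulr1.
Qed.

Lemma class_vector_orthonormal i j : index_range d i -> index_range d j ->
  inner (class_vector i) (class_vector j) = (i == j)%:R.
Proof.
move=> di dj; have [->|ij] := eqVneq i j; first exact: class_vector_norm.
have [Jt _ stj] := class_repE dj.
by rewrite innerZr class_vector_ortho ?mulr0// stj eq_sym.
Qed.

Lemma class_vector_dense :
  dense [set v : H | exists (A : {fset nat}) (a : nat -> R[i]),
    (forall i, i \in A -> index_range d i) /\
    v = \sum_(i <- A) a i *: class_vector i].
Proof.
move=> O [f Of] Oopen.
(* The frame expansion of [f] is read off as the value of a POVM on the whole line, so any labelling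
   works and the constant [0] is taken. A partial sum of it then falls into [O]. *)
have /(_ O) := usum_cvg (sub_frame_tails (fun=> 0) frame setT f).
rewrite [usum _ _]frame_povmT// => /(_ (open_nbhs_nbhs (conj Oopen Of))).
case=> B _ /(_ B (fsubset_refl _)) /= OB.
pose P : pred int := fun j => j \in [set k | J k /\ [set: R] ((fun=> 0) k)].
pose b j := inner f (e j) * inner (e j) (class_vector (class_index j)).
exists (\sum_(j <- B | P j) frame_term e f j); split => //.
exists [fset class_index j | j in B & P j]%fset.
exists (fun i => \sum_(j <- B | P j && (class_index j == i)) b j); split.
  move=> i /imfsetP[j /=]; rewrite inE => /andP[_ /set_mem[Jj _]] ->.
  exact: class_index_range.
(* The right-hand side groups the terms by class; after exchanging the sums, each [j] contributes
   only at [class_index j]. *)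
under [RHS]eq_bigr do rewrite scaler_suml big_mkcondr.
rewrite exchange_big big_seq_cond [RHS]big_seq_cond.
apply: eq_bigr => j /andP[jB Pj].
rewrite (bigD1_seq (class_index j)) ?fset_uniq//=; last first.
  by apply/imfsetP; exists j => //; rewrite inE /= jB.
rewrite eqxx big1 ?addr0 => [|i ij]; last by rewrite eq_sym (negbTE ij).
rewrite /frame_term {2}frame_class_vector ?scalerA//.
by case: (set_mem Pj).
Qed.

End Basis.
End CollinearClasses.

Lemma collinear_frame_basis (R : realType) (H : hilbertType R) (J : set int)
    (e : int -> H) :
  parseval_frame J e -> (forall j, J j -> e j != 0) ->
  (forall j k, J j -> J k -> inner (e j) (e k) != 0 ->
     exists a : R[i], e k = a *: e j) ->
  exists (d : option nat) (gamma : nat -> H)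
         (r : nat -> option nat) (c : nat -> nat -> R[i]),
     [/\ orthonormal_basis d gamma,
         exists2 phi : int -> nat * nat,
           set_bij J
             [set p | index_range d p.1 /\ index_range (r p.1) p.2] phi
           & forall j, J j -> e j = c (phi j).1 (phi j).2 *: gamma (phi j).1,
         forall i, index_range d i ->
           (\esum_(k in index_range (r i)) (complex.Re (`|c i k| ^+ 2))%:E = 1%:E)%E
       & forall i k, index_range d i -> index_range (r i) k -> c i k != 0].
Proof.
move=> frame e0 coll.
have [d [s sP]] := index_range_bij (class_rep J e @` J).
have [t tP] := set_bij_section sP.
pose ci := class_index J e s; pose gamma := class_vector e t.
(* A second numbering, inside each class: [psi i] counts the members of class [i] and [u i] inverts
   it. The pair of class and position is the re-indexing of the frame. *)
have /choice[r /choice[psi psiP]] : forall i, exists (r : option nat) psi,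
    set_bij [set j | J j /\ ci j = i] (index_range r) psi.
  by move=> i; exact: index_range_bij.
have /choice[u uP] : forall i, exists u : nat -> int, forall k,
    index_range (r i) k -> (J (u k) /\ ci (u k) = i) /\ psi i (u k) = k.
  by move=> i; exact: set_bij_section (psiP i).
have eE j : J j -> e j = inner (e j) (gamma (ci j)) *: gamma (ci j).
  exact: (frame_class_vector e0 coll sP tP).
have ciJ j : J j -> index_range d (ci j) by move=> Jj; exact: (class_index_range sP Jj).
have psiJ j : J j -> index_range (r (ci j)) (psi (ci j) j).
  by move=> Jj; have [psif _ _] := psiP (ci j); exact: psif.
have psi_inj i j k : J j -> J k -> ci j = i -> ci k = i -> psi i j = psi i k -> j = k.
  by move=> Jj Jk ij ik; have [_ psi_inj _] := psiP i; apply: psi_inj; rewrite inE.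
have uK j : J j -> u (ci j) (psi (ci j) j) = j.
  move=> Jj; have [[Ju uj] psiu] := uP _ _ (psiJ _ Jj).
  exact: psi_inj psiu.
pose c i k := inner (e (u i k)) (gamma i).
exists d, gamma, r, c; split.
- split; first exact: (class_vector_orthonormal e0 coll tP).
  exact: (class_vector_dense frame e0 coll sP tP).
- exists (fun j => (ci j, psi (ci j) j)) => [|j Jj /=]; last first.
    by rewrite /c uK// -eE.
  split=> [j Jj /=|j k /set_mem Jj /set_mem Jk []|[i k] /= [di rk]].
  + by split; [exact: ciJ|exact: psiJ].
  + by move=> jk; rewrite -jk; exact: psi_inj.
  + by have [[Ju uj] psiu] := uP _ _ rk; exists (u i k) => //; rewrite uj psiu.
- move=> i di; rewrite (reindex_esum _ _ _ _ (psiP i)).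
  (* Parseval at the unit vector [gamma i]; frame vectors outside class [i] are orthogonal to it and
     drop out. *)
  have <- : (\esum_(j in J) (complex.Re (`|inner (gamma i) (e j)| ^+ 2))%:E = 1%:E)%E.
    by rewrite frame sqr_norm_inner (class_vector_norm e0 coll tP).
  rewrite [RHS](esumID [set j | ci j = i]) => [|j _]; last first.
    by rewrite lee_fin; have := exprn_ge0 2 (normr_ge0 (inner (gamma i) (e j)));
      rewrite lecE => /andP[].
  rewrite [X in (_ + X)%E]esum1 ?adde0 => [|j [Jj /eqP ji]].
    by apply: eq_esum => j [Jj <-]; rewrite /c uK// norm_innerC.
  by rewrite (class_vector_ortho e0 coll tP)// normr0 expr0n.
- move=> i k di rk; have [[Ju uj] _] := uP _ _ rk.
  apply: contra_neq (e0 _ Ju) => c0; rewrite eE// uj -/(c i k) c0 scale0r//.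
Qed.

(** * The converse, and the equivalence *)

Lemma multiples_frame_terms_commute (R : realType) (H : hilbertType R)
    (J : set int) (e : int -> H) (d : option nat) (gamma : nat -> H)
    (n : int -> nat) (a : int -> R[i]) :
  (forall i j, index_range d i -> index_range d j ->
     inner (gamma i) (gamma j) = (i == j)%:R) ->
  (forall j, J j -> index_range d (n j) /\ e j = a j *: gamma (n j)) ->
  frame_terms_commute J e.
Proof.
move=> ortho eE j k Jj Jk f; rewrite /frame_term !innerZl.
have [dj ->] := eE _ Jj; have [dk ->] := eE _ Jk.
rewrite !innerZr !innerZl !ortho// (eq_sym (n k)) !scalerA.
(* On distinct basis vectors both compositions vanish; on a common one they are the same multiple of
   it. *)
have [->|_] := eqVneq (n j) (n k); last by rewrite !mulr0 !mul0r !scale0r.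
by congr (_ *: _); rewrite !mulr1; ring.
Qed.

Theorem theorem2 (R : realType) (H : hilbertType R) (J : set int)
    (E : int -> R) (e : int -> H) :
  separable H ->
  parseval_frame J e ->
  (forall j, J j -> e j != 0) ->
  set_inj J E ->
  commutative_povm (frame_povm J E e)
  <->
  (exists (d : option nat) (gamma : nat -> H)
          (r : nat -> option nat) (c : nat -> nat -> R[i]),
     [/\ orthonormal_basis d gamma,
         (* the frame is the family (c i k *: gamma i)_(i, k) re-indexed *)
         exists2 phi : int -> nat * nat,
           set_bij J
             [set p | index_range d p.1 /\ index_range (r p.1) p.2] phi
           & forall j, J j -> e j = c (phi j).1 (phi j).2 *: gamma (phi j).1,
         forall i, index_range d i ->
           (\esum_(k in index_range (r i)) (complex.Re (`|c i k| ^+ 2))%:E = 1%:E)%E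
       & forall i k, index_range d i -> index_range (r i) k -> c i k != 0]).
Proof.
move=> _ frame e0 Einj; rewrite (frame_terms_commuteP frame Einj); split => [comm|].
  apply: collinear_frame_basis => // j k.
  exact: frame_terms_commute_collinear.
move=> [d [gamma [r [c [[ortho _] [phi [phif _ _] eE] _ _]]]]].
apply: (multiples_frame_terms_commute (n := fun j => (phi j).1)
  (a := fun j => c (phi j).1 (phi j).2) ortho) => j Jj.
by have [d1 _] := phif _ Jj; split => //; exact: eE.
Qed.
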